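(* Let $p$ be a prime, $d$ a positive integer, and $m \ge d(p-1)+1$. Then for any continuous map $f:S^{m} \to \mathbb{R}^d$ there exist $p$ points $x_1, \dots, x_p\in S^m$ on a great circle of $S^m$ such that their pairwise spherical distances are greater than or equal to $2\pi/p$ and $f(x_1) = \dots = f(x_p)$.
   Context: $S^m$ is the unit sphere in $\mathbb{R}^{m+1}$ with the spherical (geodesic) distance. *)

(* Defs.v *)
From mathcomp Require Import all_boot all_order all_algebra.
From mathcomp Require Import all_classical all_reals all_analysis.
Import Order.TTheory GRing.Theory Num.Theory.
Import numFieldNormedType.Exports.

Set Implicit Arguments.
Unset Strict Implicit.
Unset Printing Implicit Defensive.

Local Open Scope classical_set_scope.
Local Open Scope ring_scope.

(* The library norm on 'rV[R]_n is the sup norm, so the Euclidean structure is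
   introduced here; both norms induce the same topology. *)
Definition dotp (R : realType) (n : nat) (u v : 'rV[R]_n) : R :=
  \sum_(i < n) u 0 i * v 0 i.

(* S^m, inside R^(m+1). *)
Definition sphere (R : realType) (m : nat) : set 'rV[R]_m.+1 :=
  [set x | Num.sqrt (dotp x x) = 1].

Arguments sphere : clear implicits.

(* Meaningful for u and v on the sphere only: acos takes a junk value off [-1, 1]. *)
Definition sphere_dist (R : realType) (m : nat) (u v : 'rV[R]_m.+1) : R :=
  acos (dotp u v).

Definition great_circle (R : realType) (m : nat) (C : set 'rV[R]_m.+1) : Prop :=
  exists V : {vspace 'rV[R]_m.+1},
    \dim V = 2%N /\ C = sphere R m `&` [set x | x \in V].

(* Main.v *)
(* Identify R^(2K) with C^K, where 2K is d(p-1)+1 or d(p-1)+2, so that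
   2K <= m+1. It is enough to find z on the unit sphere of C^K such that f takes
   the same value at omega^j z for all j, where omega = exp(2 i pi/p): these p
   points are equally spaced on the Hopf circle of z.

   If there is no such z, label each point x by a pair (i, a): the coordinate i
   of f oscillates the most on the orbit of x, and is maximal on that orbit at
   omega^(-a) x, ties being broken equivariantly. By continuity and compactness,
   a tuple of points of small diameter never receives a full row
   {i} x Z/p of labels.

   Label sets without a full row have at most d(p-1) elements, and Z/p acts
   freely on them because p is prime. So, starting from b_0(i,a) = a, one solves
   successively the equations delta b_0 = N b_1, delta b_1 = (g-1) b_2,
   delta b_2 = N b_3, ... between alternating cochains with coefficients in F_p
   on the labels, where g is the generator and N = 1 + g + ... + g^(p-1).
   On the sphere one builds chains h_k of tuples of small diameter with
   dh_1 = (g-1) h_0, dh_2 = N h_1, dh_3 = (g-1) h_2, ...: h_2i is the cone over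
   N h_(2i-1) with apex the i-th basis vector, and h_(2i+1) is swept by h_2i when
   the i-th coordinate is multiplied by a path from 1 to omega. Then
   1 = <(g-1) b_0, h_0> = <b_0, dh_1> = <N b_1, h_1> = <(g-1) b_2, h_2> = ...,
   but <N b_(2K-1), h_(2K-1)> = 0 because b_(2K-1) vanishes on tuples of
   2K > d(p-1) labels without a full row. *)

From mathcomp Require Import all_boot all_order all_algebra ssrAC.
Import Order.TTheory GRing.Theory Num.Theory.

Set Implicit Arguments.
Unset Strict Implicit.
Unset Printing Implicit Defensive.

Local Open Scope ring_scope.

(** * Augmented cochains on tuples and the prism homotopy *)

Section Cochains.
Variables (F : zmodType).
Implicit Types (X Y : Type).

(* Cochains live on ordered tuples and are augmented: cobd b [:: x] = b [::]. *)
Fixpoint cobd X (b : seq X -> F) (s : seq X) : F :=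
  if s is x :: t then b t - cobd (fun u => b (x :: u)) t else 0.

(* Pairing of b with the sum over i of
   (-1)^i (phi x_0, ..., phi x_i, psi x_i, ..., psi x_n). *)
Fixpoint prism X Y (phi psi : X -> Y) (b : seq Y -> F) (s : seq X) : F :=
  if s is x :: t
  then b (phi x :: psi x :: map psi t) - prism phi psi (fun u => b (phi x :: u)) t
  else 0.

Definition normalised X (b : seq X -> F) :=
  forall s1 x s2, b (s1 ++ x :: x :: s2) = 0.

(** In characteristic 2 antisymmetry does not kill tuples with a repeated entry, so normalisation is
    asked for separately. *)
Definition alternating X (b : seq X -> F) :=
  normalised b /\
  forall s1 x y s2, b (s1 ++ x :: y :: s2) = - b (s1 ++ y :: x :: s2).

Lemma eq_cobd X (b b' : seq X -> F) s : b =1 b' -> cobd b s = cobd b' s.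
Proof.
by elim: s b b' => //= x s IH b b' eb; rewrite eb (IH _ (fun u => b' (x :: u))).
Qed.

Lemma cobd0 X (s : seq X) : cobd (fun=> 0) s = 0.
Proof. by elim: s => //= x s ->; rewrite subr0. Qed.

Lemma cobdD X (b b' : seq X -> F) s :
  cobd (fun u => b u + b' u) s = cobd b s + cobd b' s.
Proof.
elim: s b b' => /= [|x s IH] b b'; first by rewrite addr0.
by rewrite IH opprD addrACA.
Qed.

Lemma cobdN X (b : seq X -> F) s : cobd (fun u => - b u) s = - cobd b s.
Proof. by elim: s b => /= [|x s IH] b; rewrite ?oppr0 // IH opprD. Qed.

Lemma cobdB X (b b' : seq X -> F) s :
  cobd (fun u => b u - b' u) s = cobd b s - cobd b' s.
Proof. by rewrite cobdD cobdN. Qed.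

Lemma cobd_sum X I (r : seq I) (b : I -> seq X -> F) s :
  cobd (fun u => \sum_(i <- r) b i u) s = \sum_(i <- r) cobd (b i) s.
Proof.
elim: r => [|i r IH].
  by rewrite big_nil -[RHS](cobd0 s); apply: eq_cobd => u; rewrite big_nil.
by rewrite big_cons -IH -cobdD; apply: eq_cobd => u; rewrite big_cons.
Qed.

Lemma cobd_map X Y (g : X -> Y) (b : seq Y -> F) s :
  cobd (fun u => b (map g u)) s = cobd b (map g s).
Proof. by elim: s b => //= x s IH b; rewrite (IH (fun u => b (g x :: u))). Qed.

Lemma cobd_cobd X (b : seq X -> F) s : cobd (cobd b) s = 0.
Proof.
elim: s b => //= x s IH b.
rewrite cobdB IH subr0; apply/eqP; rewrite subr_eq0; apply/eqP.
by apply: eq_cobd.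
Qed.

Lemma cobd_ext (X : eqType) (b b' : seq X -> F) s :
  (forall u, {subset u <= s} -> b u = b' u) -> cobd b s = cobd b' s.
Proof.
elim: s b b' => //= x s IH b b' eb; rewrite eb; last first.
  by move=> y ys; rewrite inE ys orbT.
congr (_ - _); apply: IH => u us; apply: eb => y; rewrite !inE.
by case/orP=> [->//|/us ->]; rewrite orbT.
Qed.

Lemma normalised_cons X (b : seq X -> F) x :
  normalised b -> normalised (fun u => b (x :: u)).
Proof. by move=> nb s1 y s2; apply: (nb (x :: s1)). Qed.

Lemma alternating_cons X (b : seq X -> F) x :
  alternating b -> alternating (fun u => b (x :: u)).
Proof.
by case=> nb ab; split=> [|s1 y z s2]; [exact: normalised_cons|exact: (ab (x :: s1))].
Qed.

Lemma normalised_cobd X (b : seq X -> F) : normalised b -> normalised (cobd b).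
Proof.
move=> nb s1 x s2; elim: s1 b nb => [|y s1 IH] b nb /=.
  rewrite opprB addrC subrK -[RHS](cobd0 s2).
  by apply: eq_cobd => u; apply: (nb [::]).
by rewrite nb IH ?subrr//; exact: normalised_cons.
Qed.

Lemma alternating_cobd X (b : seq X -> F) : alternating b -> alternating (cobd b).
Proof.
move=> ab; split; first by apply: normalised_cobd; case: ab.
move=> s1 x y s2; elim: s1 b ab => [|z s1 IH] b ab /=.
  rewrite (@eq_cobd _ _ (fun u => - b (y :: x :: u))); last first.
    by move=> u; rewrite (ab.2 [::]).
  by rewrite cobdN opprK opprB opprD addrA addrAC.
by rewrite ab.2 IH ?opprD//; exact: alternating_cons.
Qed.

Lemma normalised_map X Y (g : X -> Y) (b : seq Y -> F) :
  normalised b -> normalised (fun u => b (map g u)).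
Proof. by move=> nb s1 x s2; rewrite map_cat /= nb. Qed.

(** Adjacent swaps, each changing the sign, bring two equal entries side by side, where
    normalisation gives 0. *)
Lemma alternating_uniq (X : eqType) (b : seq X -> F) s :
  alternating b -> ~~ uniq s -> b s = 0.
Proof.
move=> [nb ab].
have dup s2 : forall s1 x s3, b (s1 ++ x :: s2 ++ x :: s3) = 0.
  elim: s2 => [|y s2 IH] s1 x s3; first exact: nb.
  by rewrite /= ab -cat_rcons IH oppr0.
suff H s1 : ~~ uniq s -> b (s1 ++ s) = 0 by exact: (H [::]).
elim: s s1 => //= x s IH s1; rewrite negb_and negbK => /orP[|us].
  by case/splitPr=> s2 s3; exact: dup.
by rewrite -cat_rcons IH.
Qed.

Lemma eq_prism X Y (phi psi : X -> Y) (b b' : seq Y -> F) s :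
  b =1 b' -> prism phi psi b s = prism phi psi b' s.
Proof.
by elim: s b b' => //= x s IH b b' eb; rewrite eb (IH _ (fun u => b' (phi x :: u))).
Qed.

Lemma prismB X Y (phi psi : X -> Y) (b b' : seq Y -> F) s :
  prism phi psi (fun u => b u - b' u) s = prism phi psi b s - prism phi psi b' s.
Proof.
elim: s b b' => /= [|x s IH] b b'; first by rewrite subr0.
by rewrite IH !opprD opprK addrACA.
Qed.

Lemma prism0 X Y (phi psi : X -> Y) (s : seq X) : prism phi psi (fun=> 0) s = 0.
Proof. by elim: s => //= x s ->; rewrite subr0. Qed.

Lemma prism_mapl X Y Z (g : Y -> Z) (phi psi : X -> Y) (b : seq Z -> F) s :
  prism phi psi (fun u => b (map g u)) s = prism (g \o phi) (g \o psi) b s.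
Proof.
elim: s b => //= x s IH b; rewrite -map_comp.
by rewrite (IH (fun u => b (g (phi x) :: u))).
Qed.

Lemma prism_mapr X Y Z (g : X -> Y) (phi psi : Y -> Z) (b : seq Z -> F) s :
  prism phi psi b (map g s) = prism (phi \o g) (psi \o g) b s.
Proof. by elim: s b => //= x s IH b; rewrite -map_comp IH. Qed.

Lemma prism_ext X (Y : eqType) (phi psi : X -> Y) (b b' : seq Y -> F) s :
  (forall u, size u = (size s).+1 -> {subset u <= map phi s ++ map psi s} ->
     b u = b' u) ->
  prism phi psi b s = prism phi psi b' s.
Proof.
elim: s b b' => //= x s IH b b' eb; congr (_ - _).
  apply: eb => [|y]; first by rewrite /= size_map.
  by rewrite !inE mem_cat !inE => /or3P[] ->; rewrite ?orbT.
apply: IH => u su us; apply: eb => [|y]; first by rewrite /= su.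
rewrite !inE mem_cat !inE => /orP[->//|/us].
by rewrite mem_cat => /orP[] ->; rewrite ?orbT.
Qed.

(** Chain homotopy formula: the interior faces of the prism cancel in pairs, leaving its two
    ends. *)
Lemma prism_cobd X Y (phi psi : X -> Y) (b : seq Y -> F) s :
  cobd (prism phi psi b) s + prism phi psi (cobd b) s =
  b (map psi s) - b (map phi s).
Proof.
elim: s b => /= [|x s IH] b; first by rewrite addr0 subrr.
rewrite cobdB prismB (cobd_map psi (fun u => b (phi x :: psi x :: u))).
move: (IH (fun u => b (phi x :: u))).
move: (cobd _ _) (cobd _ _) (prism _ _ _ s) (prism _ _ _ s) => A B C D.
rewrite !opprB (AC ((1*2)*((1*2)*2)) ((1*8)*(5*3)*((4*6)*(2*7))))/= => ->.
by rewrite !subrr !add0r addrA subrK.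
Qed.

Lemma normalised_prism X Y (phi psi : X -> Y) (b : seq Y -> F) :
  normalised b -> normalised (prism phi psi b).
Proof.
move=> nb s1 x s2; elim: s1 b nb => [|y s1 IH] b nb /=.
  rewrite (nb [:: phi x]) (nb [::]) !sub0r opprK -[RHS](prism0 phi psi s2).
  by apply: eq_prism => u; rewrite (nb [::]).
rewrite map_cat /= (nb [:: phi y, psi y & map psi s1]) IH ?subr0//.
exact: normalised_cons.
Qed.

(** When both maps fix the entries, every tuple of the prism repeats the entry at which it passes
    from [phi] to [psi]. *)
Lemma prism_fixed (X : eqType) (phi psi : X -> X) (b : seq X -> F) s :
  normalised b -> {in s, phi =1 id} -> {in s, psi =1 id} ->
  prism phi psi b s = 0.
Proof.
elim: s b => //= x s IH b nb fx px.
rewrite fx ?px ?inE ?eqxx// (nb [::]) sub0r IH ?oppr0//.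
- exact: normalised_cons.
- by move=> y ys; apply: fx; rewrite inE ys orbT.
- by move=> y ys; apply: px; rewrite inE ys orbT.
Qed.

End Cochains.

(** * Cochains on labels solving the equations for N and g - 1 *)

Section Labels.
Variables (p d : nat) (hp : prime p).
Local Notation V := ('I_d * 'F_p)%type.
Implicit Types (s : seq V) (A : {set 'F_p}) (a t : 'F_p) (c b : seq V -> 'F_p).

Lemma big_Fp (G : 'F_p -> 'F_p) : \sum_(t : 'F_p) G t = \sum_(i < p) G i%:R.
Proof.
rewrite -(big_mkord xpredT (fun i => G i%:R)) -[X in index_iota 0 X](Fp_cast hp).
by rewrite big_mkord; apply: eq_bigr => i _; rewrite natr_Zp.
Qed.

Definition translate t A : {set 'F_p} := [set a | a - t \in A].

Lemma translateE t A : translate t A = [set a + t | a in A].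
Proof.
apply/setP=> a; rewrite inE; apply/idP/imsetP => [aA|[b bA ->]]; last by rewrite addrK.
by exists (a - t) => //; rewrite subrK.
Qed.

Lemma card_translate t A : #|translate t A| = #|A|.
Proof. by rewrite translateE card_imset//; exact: addIr. Qed.

Definition proper_nonempty A := (A != set0) && (A != [set: 'F_p]).

Definition mean A : 'F_p := (\sum_(a in A) a) / #|A|%:R.

(** Translation by [t] adds [#|A| * t] to the sum of the elements, and [#|A|] is a unit because 0 <
    [#|A|] < [p]. *)
Lemma mean_translate t A :
  proper_nonempty A -> mean (translate t A) = mean A + t.
Proof.
move=> /andP[A0 AT]; rewrite /mean card_translate.
have nz : #|A|%:R != 0 :> 'F_p.
  rewrite -(dvdn_pcharf (pchar_Fp hp)) gtnNdvd ?card_gt0//.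
  have := subset_leq_card (subsetT A); rewrite cardsT card_Fp// leq_eqVlt.
  case/orP=> // cA; case/negP: AT; rewrite eqEcard subsetT/=.
  by rewrite cardsT card_Fp// (eqP cA).
rewrite translateE big_imset/=; last by move=> x y _ _; exact: addIr.
rewrite big_split/= sumr_const mulrDl; congr (_ + _).
by rewrite -[X in X / _]mulr_natr mulfK.
Qed.

Definition label_shift t (v : V) : V := (v.1, v.2 + t).

Lemma shiftD t t' v : label_shift t (label_shift t' v) = label_shift (t' + t) v.
Proof. by rewrite /label_shift /= addrA. Qed.

Lemma map_shiftD t t' s :
  map (label_shift t) (map (label_shift t') s) = map (label_shift (t' + t)) s.
Proof. by rewrite -map_comp; apply: eq_map => v; exact: shiftD. Qed.

Lemma map_shift0 s : map (label_shift 0) s = s.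
Proof. by rewrite -[RHS]map_id; apply: eq_map => -[i a]; rewrite /label_shift /= addr0. Qed.

Definition label_row s (i : 'I_d) : {set 'F_p} := [set a | (i, a) \in s].

Lemma row_shift t s i : label_row (map (label_shift t) s) i = translate t (label_row s i).
Proof.
apply/setP=> a; rewrite !inE; apply/mapP/idP => [[[j b] js [-> ->]]|ias].
  by rewrite addrK.
by exists (i, a - t) => //; rewrite /label_shift /= subrK.
Qed.

Definition no_full_row s := [forall i, label_row s i != [set: 'F_p]].

Lemma full_row s : ~~ no_full_row s -> exists i, forall a, (i, a) \in s.
Proof.
move=> /forallPn[i]; rewrite negbK => /eqP/setP rowi.
by exists i => a; have := rowi a; rewrite !inE.
Qed.

(** Shifts act inside rows, so the row picked is the same along an orbit; this makes [phase]
    equivariant. *)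
Definition first_row s : {set 'F_p} :=
  if [pick i | label_row s i != set0] is Some i then label_row s i else set0.

Lemma translate_eq0 t A : (translate t A == set0) = (A == set0).
Proof. by rewrite -!cards_eq0 card_translate. Qed.

Lemma translate_eqT t A : (translate t A == [set: 'F_p]) = (A == [set: 'F_p]).
Proof. by rewrite !eqEcard !subsetT /= card_translate. Qed.

Lemma no_full_row_shift t s : no_full_row (map (label_shift t) s) = no_full_row s.
Proof. by apply: eq_forallb => i; rewrite row_shift translate_eqT. Qed.

Lemma no_full_row_sub s s' : {subset s <= s'} -> no_full_row s' -> no_full_row s.
Proof.
move=> ss' /forallP g; apply/forallP=> i; apply: contra (g i).
rewrite -!subTset => /subsetP sT; apply/subsetP => a /sT.
by rewrite !inE => /ss'.
Qed.

Lemma eq_mem_row s s' : s =i s' -> label_row s =1 label_row s'.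
Proof. by move=> e i; apply/setP=> a; rewrite !inE e. Qed.

(* Primality enters here: #|A| is invertible mod p for every proper nonempty A,
   so the phase is an equivariant map to Z/p. *)
Definition phase s := mean (first_row s).

Lemma eq_mem_phase s s' : s =i s' -> phase s = phase s'.
Proof.
move=> e; rewrite /phase /first_row.
rewrite (@eq_pick _ _ (fun i => label_row s' i != set0)); last by move=> i; rewrite (eq_mem_row e).
by case: pickP => // i _; rewrite (eq_mem_row e).
Qed.

Lemma phase_shift t s : no_full_row s -> s != [::] ->
  phase (map (label_shift t) s) = phase s + t.
Proof.
move=> /forallP g s0; rewrite /phase /first_row.
rewrite (@eq_pick _ _ (fun i => label_row s i != set0)); last first.
  by move=> i; rewrite row_shift translate_eq0.
case: pickP => [i i0|no]; first by rewrite row_shift mean_translate// /proper_nonempty i0 g.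
case: s s0 {g} no => // -[i a] s _ /(_ i) /negbT; rewrite negbK => /eqP/setP/(_ a).
by rewrite !inE eqxx.
Qed.

(** Each of the [d] rows misses at least one of its [p] labels. *)
Lemma size_no_full_row s : no_full_row s -> uniq s -> (size s <= d * p.-1)%N.
Proof.
move=> /forallP g us.
have -> : size s = #|[set v in s]| by rewrite cardsE; apply/esym/card_uniqP.
rewrite -sum1_card (partition_big (fun v : V => v.1) xpredT)//=.
apply: leq_trans (_ : \sum_(i < d) p.-1 <= _)%N; last by rewrite sum_nat_const card_ord.
apply: leq_sum => i _.
have -> : (\sum_(v in [set v in s] | v.1 == i) 1 = #|label_row s i|)%N.
  rewrite -sum1_card (reindex_onto (fun a : 'F_p => (i, a)) snd)/=; last first.
    by move=> [j a] /andP[_ /eqP/= ->].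
  by apply: eq_bigl => a; rewrite !inE !eqxx !andbT.
rewrite -ltnS prednK ?prime_gt0// -[X in (_ < X)%N](card_Fp hp) -cardsT.
by apply: proper_card; rewrite properT.
Qed.

Definition orbit_sum b s : 'F_p := \sum_(t : 'F_p) b (map (label_shift t) s).

Definition restrict_cochain (P : pred (seq V)) b s : 'F_p := if P s then b s else 0.

Lemma alternating_restrict (P : pred (seq V)) b :
  (forall s s', s =i s' -> P s = P s') -> alternating b -> alternating (restrict_cochain P b).
Proof.
move=> eP [nb ab]; split=> [s1 x s2|s1 x y s2]; rewrite /restrict_cochain.
  by rewrite nb if_same.
rewrite ab (eP _ (s1 ++ y :: x :: s2)); last first.
  by move=> v; rewrite !mem_cat !inE (orbCA (v == x)).
by case: ifP; rewrite ?oppr0.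
Qed.

(* Right inverses of the orbit_sum and of g - 1, read off the phase. *)
Definition norm_lift c := restrict_cochain (fun s => phase s == 0) c.

Definition diff_lift c s : 'F_p :=
  \sum_(i < phase s) c (map (label_shift (i%:R - phase s)) s).

Lemma alternating_norm_lift c : alternating c -> alternating (norm_lift c).
Proof. by apply: alternating_restrict => s s' /eq_mem_phase ->. Qed.

Lemma alternating_diff_lift c : alternating c -> alternating (diff_lift c).
Proof.
move=> ac; split=> [s1 x s2|s1 x y s2]; rewrite /diff_lift.
  by rewrite big1// => i _; rewrite map_cat/= ac.1.
have -> : phase (s1 ++ x :: y :: s2) = phase (s1 ++ y :: x :: s2).
  by apply: eq_mem_phase => v; rewrite !mem_cat !inE (orbCA (v == x)).
by rewrite -sumrN; apply: eq_bigr => i _; rewrite !map_cat/= ac.2.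
Qed.

(** The phase takes the value 0 exactly once on the orbit of [s], so a single term of the orbit sum
    survives, and invariance of [c] identifies it with [c s]. *)
Lemma norm_liftK c s : no_full_row s -> s != [::] ->
  (forall u, no_full_row u -> c (map (label_shift 1) u) = c u) ->
  orbit_sum (norm_lift c) s = c s.
Proof.
move=> gs s0 inv.
have invn n u : no_full_row u -> c (map (label_shift n%:R) u) = c u.
  elim: n => [|n IH] gu; first by rewrite map_shift0.
  by rewrite mulrSr -map_shiftD inv ?no_full_row_shift// IH.
rewrite /orbit_sum (bigD1 (- phase s))//= big1 ?addr0 => [|t tn].
  rewrite /norm_lift /restrict_cochain phase_shift// subrr eqxx.
  by rewrite -(natr_Zp (- phase s)) invn.
by rewrite /norm_lift /restrict_cochain phase_shift// [phase s + t]addrC addr_eq0 (negbTE tn).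
Qed.

(** [diff_lift c s] adds up [c] over the shifts of [s] with phase 0, ..., [phase s - 1]; shifting
    [s] by 1 adds the term [c s]. *)
Lemma diff_liftK c s : no_full_row s -> s != [::] -> orbit_sum c s = 0 ->
  diff_lift c (map (label_shift 1) s) - diff_lift c s = c s.
Proof.
move=> gs s0 nc; rewrite /diff_lift phase_shift//.
pose G (i : nat) := c (map (label_shift (i%:R - phase s)) s).
have GE n : \sum_(i < n) c (map (label_shift (i%:R - (phase s + 1))) (map (label_shift 1) s)) =
    \sum_(i < n) G i.
  by apply: eq_bigr => i _; rewrite map_shiftD opprD addrCA (addrC 1) subrK.
have Gn : G (phase s) = c s by rewrite /G natr_Zp subrr map_shift0.
have ltp : (phase s < p)%N by rewrite -[X in (_ < X)%N](Fp_cast hp) ltn_ord.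
have valS : (phase s + 1 : 'F_p) = ((phase s).+1 %% p)%N :> nat.
  have -> : phase s + 1 = (phase s).+1%:R by rewrite mulrSr natr_Zp.
  exact: val_Fp_nat.
have sumG : \sum_(i < p) G i = 0.
  by apply: etrans nc; rewrite /orbit_sum (reindex_inj (addIr (- phase s)))/= big_Fp.
rewrite GE -Gn valS; have [Slt|] := ltnP (phase s).+1 p.
  by rewrite modn_small// big_ord_recr/= addrAC subrr add0r.
(* The phase wraps around from p - 1 to 0: the new sum is empty, and the vanishing orbit sum
   supplies the missing value. *)
move=> pS; have pE : (phase s).+1 = p by apply/eqP; rewrite eqn_leq ltp.
rewrite pE modnn big_ord0 sub0r; apply/eqP; rewrite eq_sym -addr_eq0 addrC.
move: sumG; rewrite -(big_mkord xpredT G) -[X in index_iota 0 X]pE.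
by rewrite big_nat_recr//= big_mkord => ->.
Qed.

Fixpoint label_cochain k : seq V -> 'F_p :=
  if k is k'.+1 then
    if odd k' then diff_lift (cobd (label_cochain k'))
    else norm_lift (cobd (label_cochain k'))
  else fun s => if s is [:: v] then v.2 else 0.

Lemma label_cochainS k : label_cochain k.+1 =
  if odd k then diff_lift (cobd (label_cochain k))
  else norm_lift (cobd (label_cochain k)).
Proof. by []. Qed.

Lemma alternating_label_cochain k : alternating (label_cochain k).
Proof.
elim: k => [|k IH] /=.
  split=> [s1 x s2|s1 x y s2]; case: s1 => [|z [|z' s1]] //=; by rewrite oppr0.
by case: ifP => _; [apply: alternating_diff_lift|apply: alternating_norm_lift];
  apply: alternating_cobd.
Qed.

Lemma label_cochain_nil k : label_cochain k [::] = 0.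
Proof.
elim: k => //= k IH; case: ifP => _; last by rewrite /norm_lift /restrict_cochain if_same.
by rewrite /diff_lift big1.
Qed.

Lemma label_cochain0_shift s :
  label_cochain 0 (map (label_shift 1) s) - label_cochain 0 s = (size s == 1%N)%:R.
Proof. by case: s => [|v [|w s]] //=; rewrite ?subrr// addrC addKr. Qed.

(** Each lift is a right inverse only on cochains killed by the complementary operator, g - 1 for N
    and N for g - 1. This condition is the coboundary of the previous equation, since delta delta =
    0. *)
Lemma cobd_label_cochain k s : no_full_row s ->
  cobd (label_cochain k) s =
    if odd k then label_cochain k.+1 (map (label_shift 1) s) - label_cochain k.+1 s
    else orbit_sum (label_cochain k.+1) s.
Proof.
have [->|s0] := eqVneq s [::].
  case: ifP => _ _; first by rewrite !label_cochain_nil subrr.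
  by rewrite /orbit_sum big1// => t _; rewrite label_cochain_nil.
elim: k s s0 => [|k IH] s s0 gs.
  rewrite /= norm_liftK// => u _; apply/eqP; rewrite -subr_eq0 -cobd_map -cobdB; apply/eqP.
  (* (g - 1) b_0 is 1 on single labels and 0 elsewhere, which is the coboundary of the indicator of
     the empty tuple. *)
  rewrite (eq_cobd _ label_cochain0_shift) -[RHS](cobd_cobd (fun v => (nilp v)%:R) u).
  by apply: eq_cobd => -[|v [|w t]] /=; rewrite ?cobd0 ?subr0.
have sub u v : no_full_row u -> {subset v <= u} -> no_full_row v.
  by move=> gu vu; exact: no_full_row_sub vu gu.
(* [T] is the right-hand side one degree lower; by induction it agrees with [cobd (label_cochain k)]
   on tuples without a full row. *)
pose T v := if odd k then label_cochain k.+1 (map (label_shift 1) v) - label_cochain k.+1 v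
  else orbit_sum (label_cochain k.+1) v.
have cc u : no_full_row u -> cobd T u = 0.
  move=> gu; rewrite -[RHS](cobd_cobd (label_cochain k) u); apply: cobd_ext => v vu.
  rewrite /T; have [->|v0] := eqVneq v [::]; last by rewrite IH//; exact: sub vu.
  case: ifP => _; first by rewrite !label_cochain_nil subrr.
  by rewrite /orbit_sum big1// => t _; rewrite label_cochain_nil.
rewrite (label_cochainS k.+1) [odd k.+1]/=; move: cc; rewrite /T; case: (odd k) => /= cc.
  rewrite norm_liftK// => u gu; apply/eqP; rewrite -subr_eq0 -cobd_map -cobdB.
  exact/eqP/cc.
rewrite diff_liftK// -[RHS](cc s gs) /orbit_sum cobd_sum.
by apply: eq_bigr => t _; rewrite cobd_map.
Qed.

Lemma label_cochain_large k s : no_full_row s -> (d * p.-1 < size s)%N ->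
  label_cochain k s = 0.
Proof.
move=> gs; rewrite ltnNge => ss; apply: alternating_uniq.
  exact: alternating_label_cochain.
by apply: contra ss; exact: size_no_full_row.
Qed.

End Labels.

(** * Equivariant labels read off a table of values on an orbit *)

Section TableLabel.
Variables (R : realDomainType) (p d : nat) (hp : prime p) (i0 : 'I_d).
Local Notation table := ('F_p -> 'I_d -> R).
Implicit Types (Y : table) (t a b : 'F_p) (i j : 'I_d).

Definition shift_table t Y : table := fun a => Y (a - t).

Definition widest_row Y i :=
  [exists q : 'F_p * 'F_p, forall r : 'I_d * ('F_p * 'F_p),
     Y r.2.1 r.1 - Y r.2.2 r.1 <= Y q.1 i - Y q.2 i].

Definition argmaxs Y i := [set a | [forall b, Y b i <= Y a i]].

(* The mean of A need not belong to A; translating it to 0 makes the choice of an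
   element of A equivariant. *)
Definition select (A : {set 'F_p}) : 'F_p :=
  odflt 0 [pick a in translate (- mean A) A] + mean A.

Definition table_label Y : 'I_d * 'F_p :=
  let i := odflt i0 [pick i | widest_row Y i] in (i, select (argmaxs Y i)).

Lemma select_in A : A != set0 -> select A \in A.
Proof.
move=> /set0Pn[a aA]; rewrite /select; case: pickP => [b|/(_ (a - mean A))].
  by rewrite inE opprK.
by rewrite inE opprK subrK aA.
Qed.

Lemma translateD t t' (A : {set 'F_p}) : translate t (translate t' A) = translate (t + t') A.
Proof. by apply/setP=> a; rewrite !inE opprD addrA. Qed.

Lemma select_translate t A : proper_nonempty A -> select (translate t A) = select A + t.
Proof.
move=> pA; rewrite /select mean_translate// translateD opprD subrK addrA.
by [].
Qed.

Lemma widest_row_ex Y : exists i, widest_row Y i.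
Proof.
pose D (r : 'I_d * ('F_p * 'F_p)) := Y r.2.1 r.1 - Y r.2.2 r.1.
case: (@Order.TotalTheory.arg_maxP _ _ _ (i0, (0, 0)) xpredT D isT) => -[i q] _ qmax.
by exists i; apply/existsP; exists q; apply/forallP => r; exact: qmax.
Qed.

Lemma argmaxs_neq0 Y i : argmaxs Y i != set0.
Proof.
case: (@Order.TotalTheory.arg_maxP _ _ _ 0 xpredT (fun a => Y a i) isT) => a _ amax.
by apply/set0Pn; exists a; rewrite inE; apply/forallP => b; exact: amax.
Qed.

Lemma table_label_spec Y i a : table_label Y = (i, a) ->
  (forall b, Y b i <= Y a i) /\
  exists a0 b0, forall j b c, Y b j - Y c j <= Y a0 i - Y b0 i.
Proof.
rewrite /table_label; case: pickP => [i'|no]; last first.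
  by have [i' wi'] := widest_row_ex Y; rewrite no in wi'.
move=> /existsP[[a0 b0] /forallP w] /= [<- <-]; split=> [b|].
  by have := select_in (argmaxs_neq0 Y i'); rewrite inE => /forallP.
by exists a0, b0 => j b c; exact: (w (j, (b, c))).
Qed.

Lemma widest_row_shift t Y i : widest_row (shift_table t Y) i = widest_row Y i.
Proof.
apply/existsP/existsP => -[[a0 b0] /forallP w].
  exists (a0 - t, b0 - t); apply/forallP => -[j [a b]].
  by have := w (j, (a + t, b + t)); rewrite /shift_table /= !addrK.
exists (a0 + t, b0 + t); apply/forallP => -[j [a b]].
by have := w (j, (a - t, b - t)); rewrite /shift_table /= !addrK.
Qed.

Lemma argmaxs_shift t Y i : argmaxs (shift_table t Y) i = translate t (argmaxs Y i).
Proof.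
apply/setP=> a; rewrite !inE; apply/forallP/forallP => amax b.
  by have := amax (b + t); rewrite /shift_table addrK.
exact: amax.
Qed.

(** The set of maxima in the widest row is proper: otherwise the largest oscillation would be 0 and
    every row constant. Hence the selection in it is equivariant. *)
Lemma table_label_shift t Y : (exists j a b, Y a j != Y b j) ->
  table_label (shift_table t Y) = label_shift t (table_label Y).
Proof.
move=> [j [a [b ab]]]; rewrite /table_label (eq_pick (widest_row_shift t Y)).
case: pickP => [i /existsP[[a0 b0] /forallP w]|no]; last first.
  by have [i' wi'] := widest_row_ex Y; rewrite no in wi'.
rewrite /label_shift /= argmaxs_shift select_translate// /proper_nonempty argmaxs_neq0/=.
apply: contra ab => /eqP/setP amax.
have wi c c' : Y c i <= Y c' i by have := amax c'; rewrite !inE => /forallP.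
have D0 : Y a0 i - Y b0 i <= 0 by rewrite subr_le0.
have := le_trans (w (j, (a, b))) D0; have := le_trans (w (j, (b, a))) D0.
by rewrite /= !subr_le0 => ba ab; rewrite eq_le ab ba.
Qed.

End TableLabel.

Require Import Defs.
From mathcomp Require Import complex zify ring lra.
From mathcomp Require Import all_classical all_reals all_analysis.
Import numFieldNormedType.Exports.


(** * Chains as functionals, and homotopies along a finite sequence of maps *)

Section Chains.
Variables (F : zmodType).

(* A chain is encoded by its pairing with cochains; Q contains its support. *)
Definition chain_on X (Q : seq X -> Prop) (h : (seq X -> F) -> F) :=
  {morph h : b b' / (fun s => b s - b' s) >-> b - b'} /\
  (forall b b', (forall s, Q s -> b s = b' s) -> h b = h b').

Section ChainTheory.
Variables (X : Type) (Q : seq X -> Prop) (h : (seq X -> F) -> F).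
Hypothesis hh : chain_on Q h.
Implicit Types b : seq X -> F.

Lemma chainB b b' : h (fun s => b s - b' s) = h b - h b'.
Proof. exact: hh.1. Qed.

Lemma eq_chain b b' : b =1 b' -> h b = h b'.
Proof. by move=> eb; apply: hh.2 => s _. Qed.

Lemma chain0 b : (forall s, Q s -> b s = 0) -> h b = 0.
Proof.
move=> b0; rewrite -(subrr (h b)) -chainB; apply: hh.2 => s Qs.
by rewrite subrr b0.
Qed.

Lemma chainN b : h (fun s => - b s) = - h b.
Proof.
rewrite -[RHS]sub0r -(@chain0 (fun=> 0))// -chainB.
by apply: eq_chain => s; rewrite sub0r.
Qed.

Lemma chainD b b' : h (fun s => b s + b' s) = h b + h b'.
Proof.
rewrite -[h b' in RHS]opprK -chainN -chainB.
by apply: eq_chain => s; rewrite opprK.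
Qed.

Lemma chain_sum I (r : seq I) (b : I -> seq X -> F) :
  h (fun s => \sum_(i <- r) b i s) = \sum_(i <- r) h (b i).
Proof.
elim: r => [|i r IH].
  by rewrite big_nil chain0// => s _; rewrite big_nil.
rewrite big_cons -IH -chainD.
by apply: eq_chain => s; rewrite big_cons.
Qed.

End ChainTheory.

Section Homotopy.
Variables (X : eqType) (phi : nat -> X -> X).
Implicit Types b : seq X -> F.

Definition homotopy r b s := \sum_(k < r) prism (phi k) (phi k.+1) b s.

(** The prism formulas of consecutive maps telescope. *)
Lemma homotopy_cobd r b s :
  cobd (homotopy r b) s + homotopy r (cobd b) s =
  b (map (phi r) s) - b (map (phi 0%N) s).
Proof.
rewrite /homotopy cobd_sum -big_split/= (eq_bigr (fun k : 'I_r =>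
  b (map (phi k.+1) s) - b (map (phi k) s))); last by move=> k _; exact: prism_cobd.
by rewrite -(big_mkord xpredT (fun k => b (map (phi k.+1) s) - b (map (phi k) s)))
  telescope_sumr.
Qed.

Lemma normalised_homotopy r b : normalised b -> normalised (homotopy r b).
Proof.
by move=> nb s1 x s2; rewrite /homotopy big1// => k _; exact: normalised_prism.
Qed.

Lemma homotopy_fixed r b s : normalised b ->
  (forall k, {in s, phi k =1 id}) -> homotopy r b s = 0.
Proof.
by move=> nb fs; rewrite /homotopy big1// => k _; apply: prism_fixed.
Qed.

Lemma homotopyB r b b' s :
  homotopy r (fun u => b u - b' u) s = homotopy r b s - homotopy r b' s.
Proof. by rewrite /homotopy -sumrB; apply: eq_bigr => k _; exact: prismB. Qed.

(** The prism over [s] only evaluates tuples with one more entry, taken from two consecutive images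
    of [s]; this controls the support. *)
Lemma homotopy_chain (Q Q' : seq X -> Prop) r h :
  chain_on Q h ->
  (forall k s u, Q s -> size u = (size s).+1 ->
     {subset u <= map (phi k) s ++ map (phi k.+1) s} -> Q' u) ->
  chain_on Q' (fun b => h (homotopy r b)).
Proof.
move=> hh QQ'; split=> [b b'|b b' eb].
  rewrite -(chainB hh); apply: (eq_chain hh) => s; exact: homotopyB.
apply: hh.2 => s Qs; apply: eq_bigr => k _; apply: prism_ext => u su us.
by apply: eb; exact: QQ' us.
Qed.

End Homotopy.

End Chains.

(** * Chains of small mesh on the sphere of C^K *)

Section Sphere.
Variables (C : numFieldType) (p : nat) (hp : prime p) (omega : C).
Hypotheses (omegap : omega ^+ p = 1) (K : nat).
Local Notation X := (nat -> C).
Local Notation cochain := (seq X -> 'F_p).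
Implicit Types (x y : X) (s : seq X) (b : cochain) (eps delta : C) (t : 'F_p).

(* The unit sphere of the span of the first i basis vectors of C^K. *)
Definition sph i x :=
  \sum_(l < K) `|x l| ^+ 2 = 1 /\ forall l, (i <= l)%N -> x l = 0.

Definition simplex delta i n s :=
  [/\ size s = n, {in s, forall x, sph i x} &
    {in s &, forall x y l, `|x l - y l| <= delta}].

(** The exponent is the representative of [t] in 0, ..., p - 1; [omega ^+ p = 1] makes this an
    action of Z/p. *)
Definition rot_act t x : X := fun l => omega ^+ t * x l.

Lemma norm_omega n : `|omega ^+ n| = 1.
Proof.
rewrite normrX; suff -> : `|omega| = 1 by rewrite expr1n.
apply/eqP; rewrite -(@pexpr_eq1 _ _ p) ?prime_gt0//.
by rewrite -normrX omegap normr1.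
Qed.

Lemma omegaD t t' : omega ^+ (t + t')%R = omega ^+ t * omega ^+ t'.
Proof.
rewrite -exprD -[X in omega ^+ _ = X](expr_mod _ omegap); congr (_ ^+ _).
by rewrite -[X in (_ %% X)%N](Fp_cast hp).
Qed.

Lemma actD t t' x : rot_act t (rot_act t' x) = rot_act (t' + t) x.
Proof. by apply/funext => l; rewrite /rot_act mulrA -omegaD addrC. Qed.

Lemma act1E x l : rot_act 1 x l = omega * x l.
Proof.
by rewrite /rot_act; congr (_ * _); rewrite -[in RHS](expr1 omega); congr (_ ^+ _);
  rewrite /= modn_small.
Qed.

Lemma sph_act t i x : sph i x -> sph i (rot_act t x).
Proof.
case=> ux zx; split=> [|l il]; last by rewrite /rot_act zx// mulr0.
by rewrite -[RHS]ux; apply: eq_bigr => l _; rewrite /rot_act normrM norm_omega mul1r.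
Qed.

Lemma simplex_act t delta i n s :
  simplex delta i n s -> simplex delta i n (map (rot_act t) s).
Proof.
case=> ss us cs; split=> [|x|x y]; first by rewrite size_map.
  by case/mapP=> y ys ->; apply: sph_act; exact: us.
case/mapP=> x' xs ->; case/mapP=> y' ys -> l.
by rewrite /rot_act -mulrBr normrM norm_omega mul1r; exact: cs.
Qed.

Lemma sph_le1 i x l : (i <= K)%N -> sph i x -> `|x l| <= 1.
Proof.
move=> iK [ux zx]; have [lK|Kl] := ltnP l K; last first.
  by rewrite zx ?normr0 ?ler01// (leq_trans iK).
rewrite -(@expr_le1 _ 2)// -ux (bigD1 (Ordinal lK))//= lerDl.
by apply: sumr_ge0 => j _; rewrite exprn_ge0.
Qed.

Lemma close_mul (delta a a' u v : C) : `|a| <= 1 -> `|v| <= 1 ->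
  `|a - a'| <= delta / 2 -> `|u - v| <= delta / 2 -> `|a * u - a' * v| <= delta.
Proof.
move=> a1 v1 aa uv; have -> : a * u - a' * v = a * (u - v) + (a - a') * v.
  by rewrite mulrBr mulrBl addrA subrK.
rewrite (le_trans (ler_normD _ _))// [leRHS](splitr delta) !normrM.
apply: lerD; first by rewrite (le_trans _ uv)// ler_piMl.
by rewrite (le_trans _ aa)// ler_piMr.
Qed.

Definition basis i : X := fun l => (l == i)%:R.

Lemma sph_basis i : (i < K)%N -> sph i.+1 (basis i).
Proof.
move=> iK; split=> [|l il]; last by rewrite /basis gtn_eqF.
rewrite (bigD1 (Ordinal iK))//= {1}/basis eqxx normr1 expr1n big1 ?addr0//.
move=> j ji; rewrite /basis (_ : (j == i :> nat) = false) ?normr0 ?expr0n//.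
by apply: contraNF ji => /eqP ji; apply/eqP/val_inj.
Qed.

(** The parameters (0, 1) give the constant map to the apex [basis i], and (1, 0) the identity on
    points whose coordinate [i] is 0. *)
Definition cone_map i (c w : C) x : X := fun l => if l == i then w else c * x l.

Definition rotate i (u : C) x : X := fun l => if l == i then u * x l else x l.

Lemma sph_cone_map i c w x : (i < K)%N -> `|c| ^+ 2 + `|w| ^+ 2 = 1 ->
  sph i x -> sph i.+1 (cone_map i c w x).
Proof.
move=> iK ct [ux zx]; split=> [|l il]; last first.
  by rewrite /cone_map gtn_eqF// zx ?mulr0// ltnW.
have ji (j : 'I_K) : j != Ordinal iK -> (j == i :> nat) = false.
  by move=> ji; apply: contraNF ji => /eqP ji; apply/eqP/val_inj.
move: ux; rewrite (bigD1 (Ordinal iK))//= zx// normr0 expr0n/= add0r => ux.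
rewrite (bigD1 (Ordinal iK))//= {1}/cone_map eqxx.
rewrite (eq_bigr (fun j : 'I_K => `|c| ^+ 2 * `|x j| ^+ 2)).
  by rewrite -mulr_sumr ux mulr1 addrC.
by move=> j /ji ij; rewrite /cone_map ij normrM exprMn.
Qed.

Lemma sph_rotate i j u x : `|u| = 1 -> sph i x -> sph i (rotate j u x).
Proof.
move=> u1 [ux zx]; split=> [|l il]; last by rewrite /rotate zx// mulr0 if_same.
rewrite -[RHS]ux; apply: eq_bigr => l _; rewrite /rotate; case: ifP => //.
by rewrite normrM u1 mul1r.
Qed.

(** Discretised paths are assumed here and supplied later by cosine and sine: arcs to [omega] for
    [rotate], quarter circles for [cone_map]. *)
Hypothesis rot_path : forall eps, 0 < eps -> exists r (u : nat -> C),
  [/\ u 0%N = 1, u r = omega, forall k, `|u k| = 1 &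
    forall k, `|u k.+1 - u k| <= eps].

Hypothesis cone_path : forall eps, 0 < eps -> exists r (c t : nat -> C),
  [/\ c 0%N = 0 /\ t 0%N = 1, c r = 1 /\ t r = 0,
     forall k, `|c k| ^+ 2 + `|t k| ^+ 2 = 1 &
     forall k, `|c k.+1 - c k| <= eps /\ `|t k.+1 - t k| <= eps].

(** [B k] will be [label_cochain k] composed with the labelling, and the hypotheses on [B] are the
    equations solved by the label cochains. *)
Variables (B : nat -> cochain) (delta0 : C).
Hypothesis delta0_gt0 : 0 < delta0.
Hypothesis normB : forall k, normalised (B k).
Hypothesis B0 : forall s, simplex delta0 K 1 s -> B 0 (map (rot_act 1) s) - B 0 s = 1.
Hypothesis B_cobd : forall k n s, simplex delta0 K n s ->
  cobd (B k) s = if odd k then B k.+1 (map (rot_act 1) s) - B k.+1 s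
                 else \sum_t B k.+1 (map (rot_act t) s).

Lemma simplexW delta delta' i j n s : delta <= delta' -> (i <= j)%N ->
  simplex delta i n s -> simplex delta' j n s.
Proof.
move=> dd ij [ss us cs]; split=> // [x /us [ux zx]|x y xs ys l].
  by split=> // l jl; apply: zx; exact: leq_trans jl.
by apply: le_trans dd; exact: cs.
Qed.

(* z is the boundary of the even-dimensional chain h; the rotation fixes its
   support pointwise, so that it contributes only degenerate tuples. *)
Lemma even_chain_odd_chain i delta : (i < K)%N -> 0 < delta -> delta <= delta0 ->
  (exists h z : cochain -> 'F_p,
   [/\ chain_on (simplex (delta / 2) i.+1 (2 * i + 1)) h /\
       chain_on (simplex (delta / 2) i (2 * i)) z,
    forall b, normalised b -> h (cobd b) = z b,
    forall b, h (fun s => b (map (rot_act 1) s)) = h (fun s => b (map (rotate i omega) s)) &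
    h (fun s => B (2 * i) (map (rot_act 1) s) - B (2 * i)%N s) = 1]) ->
  exists h : cochain -> 'F_p,
   [/\ chain_on (simplex delta i.+1 (2 * i + 2)) h,
    (exists h', (forall b b', h' (fun s => b s - b' s) = h' b - h' b') /\
        forall b, normalised b ->
       h (cobd b) = h' (fun s => b (map (rot_act 1) s) - b s)) &
    h (cobd (B (2 * i))) = 1].
Proof.
move=> iK d0 dd0 [h [z [[hh hz] hd hg hB]]].
have [r [u [u0 ur u1 uu]]] := rot_path (divr_gt0 d0 (ltr0n C 2)).
pose phi k := rotate i (u k).
(* The homotopy runs from the identity to [rotate i omega], which [h] does not distinguish from g;
   the other boundary term lives on [z], where the homotopy is stationary. *)
have key b : normalised b -> h (homotopy phi r (cobd b)) =
    h (fun s => b (map (rot_act 1) s) - b s).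
  move=> nb; rewrite (chainB hh) hg -[LHS]addr0.
  have <- : h (cobd (homotopy phi r b)) = 0.
    rewrite hd; last exact: normalised_homotopy.
    apply: (chain0 hz) => s [_ us _]; apply: homotopy_fixed => // k x /us [_ zx].
    by apply/funext => l; rewrite /phi /rotate; case: eqP => // ->; rewrite zx ?mulr0.
  rewrite -(chainD hh) -(chainB hh); apply: (eq_chain hh) => s.
  rewrite addrC homotopy_cobd; congr (b _ - b _); first by rewrite /phi ur.
  rewrite -[RHS]map_id; apply: eq_map => x; apply/funext => l.
  by rewrite /phi u0 /rotate mul1r if_same.
exists (fun b => h (homotopy phi r b)); split.
- apply: (homotopy_chain r hh) => k s v [ss us cs] sv vs; split=> [|x /vs|x y /vs xv /vs yv l].
  + by rewrite sv ss addn1 addn2.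
  + by rewrite mem_cat => /orP[] /mapP[x' /us xs ->]; apply: sph_rotate.
  + have uk j j' : j \in [:: k; k.+1] -> j' \in [:: k; k.+1] -> `|u j - u j'| <= delta / 2.
      rewrite !inE => /orP[] /eqP-> /orP[] /eqP->; rewrite ?subrr ?normr0 ?divr_ge0 ?(ltW d0)//.
      by rewrite distrC.
    have im w : w \in map (phi k) s ++ map (phi k.+1) s ->
        exists2 j, j \in [:: k; k.+1] & exists2 w', w' \in s & w = phi j w'.
      by rewrite mem_cat => /orP[] /mapP[w' ws ->]; [exists k|exists k.+1];
        rewrite ?inE ?eqxx ?orbT//; exists w'.
    have [j jk [x' xs ->]] := im _ xv; have [j' jk' [y' ys ->]] := im _ yv.
    rewrite /phi /rotate; case: ifP => _.
      apply: close_mul; [by rewrite u1|exact/sph_le1/us|exact: uk|exact: cs].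
    by apply: le_trans (cs _ _ xs ys l) _; rewrite ler_pdivrMr// ler_peMr ?ler1n// ltW.
- by exists h; split; [exact: chainB hh|exact: key].
- by rewrite key.
Qed.

Lemma sum_shift_act (G : 'F_p -> 'F_p) : \sum_t G (1 + t) = \sum_t G t.
Proof. by rewrite [RHS](reindex_inj (addrI 1)). Qed.

(** Induction on [i], with [h] = h_2i and [z] its boundary N h_(2i-1). As [z] is invariant, g maps
    the cone over [z] to the cone whose apex is multiplied by omega, so on [h] it agrees with
    rotating coordinate [i]. *)
Lemma even_chain i delta : (i < K)%N -> 0 < delta -> delta <= delta0 ->
  exists h z : cochain -> 'F_p,
   [/\ chain_on (simplex delta i.+1 (2 * i + 1)) h /\
       chain_on (simplex delta i (2 * i)) z,
    forall b, normalised b -> h (cobd b) = z b,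
    forall b, h (fun s => b (map (rot_act 1) s)) = h (fun s => b (map (rotate i omega) s)) &
    h (fun s => B (2 * i) (map (rot_act 1) s) - B (2 * i)%N s) = 1].
Proof.
elim: i delta => [|i IH] delta iK d0 dd0.
  (* h_0 is the point [basis 0]; its augmented boundary is the empty tuple. *)
  exists (fun b => b [:: basis 0]), (fun b => b [::]); split.
  - split; split=> // b b'; apply; split=> //.
      by move=> x; rewrite inE => /eqP->; exact: sph_basis.
    by move=> x y /predU1P[->|//] /predU1P[->|//] l; rewrite subrr normr0 ltW.
  - by move=> b _ /=; rewrite subr0.
  - move=> b /=; congr (b [:: _]); apply/funext => l.
    rewrite act1E /rotate /basis; case: eqP => // _; by rewrite mulr0.
  - apply: B0; split=> //; last first.
      by move=> x y /predU1P[->|//] /predU1P[->|//] l; rewrite subrr normr0 ltW.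
    move=> x; rewrite inE => /eqP->; have [ux zx] := sph_basis iK; split=> // l Kl.
    by apply: zx; exact: leq_trans Kl.
(* Each of the two homotopies, rotation and cone, doubles the mesh bound, so h_2i is taken with
   bound [delta / 4]. *)
have d20 : 0 < delta / 2 by rewrite divr_gt0.
have d2d : delta / 2 <= delta by rewrite ler_pdivrMr// ler_peMr ?ler1n// ltW.
have d40 : 0 < delta / 2 / 2 by rewrite divr_gt0.
have d4d : delta / 2 / 2 <= delta / 2 by rewrite ler_pdivrMr// ler_peMr ?ler1n// ltW.
have := even_chain_odd_chain (ltnW iK) d20 (le_trans d2d dd0)
  (IH _ (ltnW iK) d40 (le_trans (le_trans d4d d2d) dd0)).
case=> h [hh [h' [h'B h'd]] hB].
pose z (b : cochain) := \sum_t h (fun s => b (map (rot_act t) s)).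
have n2 : (2 * i + 2 = 2 * i.+1)%N by rewrite mulnS addnC.
have hz : chain_on (simplex (delta / 2) i.+1 (2 * i.+1)) z.
  rewrite -n2; split=> [b b'|b b' eb].
    by rewrite /z -sumrB; apply: eq_bigr => t _; rewrite -(chainB hh).
  by apply: eq_bigr => t _; apply: hh.2 => s /(simplex_act t)/eb.
have zg b : z (fun s => b (map (rot_act 1) s)) = z b.
  rewrite /z -[RHS]sum_shift_act; apply: eq_bigr => t _.
  apply: (eq_chain hh) => s; rewrite -map_comp; congr b; apply: eq_map => x /=.
  by rewrite actD addrC.
(* This is N (g - 1) = 0, since the boundary of [h] is (g - 1) h'. *)
have zd b : normalised b -> z (cobd b) = 0.
  move=> nb; rewrite /z; pose G t := h' (fun s => b (map (rot_act t) s)).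
  rewrite (eq_bigr (fun t => G (1 + t) - G t)).
    by rewrite sumrB sum_shift_act subrr.
  move=> t _; rewrite -h'B.
  pose bt s := b (map (rot_act t) s).
  have -> : (fun s => b (map (rot_act (1 + t)) s) - b (map (rot_act t) s)) =
     (fun s => bt (map (rot_act 1) s) - bt s).
    apply/funext => s; rewrite /bt -map_comp; congr (b _ - _); apply: eq_map => x /=.
    by rewrite actD.
  rewrite -h'd; last exact: normalised_map.
  by apply: (eq_chain hh) => s; rewrite cobd_map.
(* The sum over the action moves onto the cochain, where N B_(2i+1) = delta B_2i. *)
have zB : z (B (2 * i).+1) = 1.
  rewrite -hB /z -(chain_sum hh); apply: hh.2 => s Qs.
  rewrite (B_cobd _ (simplexW (le_trans d2d dd0) (ltnW iK) Qs)).
  by rewrite mul2n odd_double.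
have [r [c [w [[c0 w0] [cr wr] cw1 cw]]]] := cone_path d20.
pose phi k := cone_map i.+1 (c k) (w k).
have hhz : chain_on (simplex delta i.+2 (2 * i.+1 + 1)) (fun b => z (homotopy phi r b)).
  apply: (homotopy_chain r hz) => k s v [ss us cs] sv vs; split=> [|x /vs|x y /vs xv /vs yv l].
  - by rewrite sv ss addn1.
  - by rewrite mem_cat => /orP[] /mapP[x' /us xs ->]; apply: sph_cone_map.
  - have ck j j' : j \in [:: k; k.+1] -> j' \in [:: k; k.+1] ->
        `|c j - c j'| <= delta / 2 /\ `|w j - w j'| <= delta / 2.
      have [ck wk] := cw k; rewrite !inE => /orP[] /eqP-> /orP[] /eqP->;
       by rewrite ?subrr ?normr0 ?[`|_ k - _|]distrC; split=> //; apply: ltW.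
    have im v' : v' \in map (phi k) s ++ map (phi k.+1) s ->
        exists2 j, j \in [:: k; k.+1] & exists2 w', w' \in s & v' = phi j w'.
      by rewrite mem_cat => /orP[] /mapP[w' ws ->]; [exists k|exists k.+1];
        rewrite ?inE ?eqxx ?orbT//; exists w'.
    have [j jk [x' xs ->]] := im _ xv; have [j' jk' [y' ys ->]] := im _ yv.
    have [cjj wjj] := ck _ _ jk jk'; rewrite /phi /cone_map; case: ifP => _.
      exact: le_trans wjj d2d.
    apply: close_mul => //; [|exact: sph_le1 (ltnW iK) (us _ ys)|exact: cs].
    by rewrite -(@expr_le1 _ 2)// -(cw1 j) lerDl exprn_ge0.
have hd b : normalised b -> z (homotopy phi r (cobd b)) = z b.
  move=> nb; rewrite -[LHS]addr0 -(zd _ (normalised_homotopy phi r nb)).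
  rewrite -(chainD hz); apply: hz.2 => s [ss us _].
  rewrite addrC homotopy_cobd [X in _ - X](_ : _ = 0) ?subr0.
    congr b; rewrite -[RHS]map_id; apply/eq_in_map => x /us [_ zx].
    apply/funext => l; rewrite /phi /cone_map cr wr mul1r; case: eqP => // ->.
    by rewrite zx.
  (* The homotopy starts at the constant map to the apex, and a constant tuple with at least 2
     entries is degenerate. *)
  have cst x y : phi 0%N x = phi 0%N y.
    by apply/funext => l; rewrite /phi /cone_map c0 !mul0r.
  case: s ss {us} => [|x [|y s]] //=; first by rewrite mulnS.
  by move=> _; rewrite (cst y x); exact: (nb [::]).
exists (fun b => z (homotopy phi r b)), z; split=> //.
- split=> //; split; first exact: hz.1.
  by move=> b b' eb; apply: hz.2 => s Qs; apply: eb; exact: simplexW Qs.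
- move=> b; rewrite -(zg (homotopy phi r (fun s => b (map (rotate i.+1 omega) s)))).
  apply: (eq_chain hz) => s; apply: eq_bigr => k _.
  rewrite prism_mapr [LHS](prism_mapl (rot_act 1)) [RHS](prism_mapl (rotate i.+1 omega)).
  have E j : rot_act 1 \o phi j = rotate i.+1 omega \o (phi j \o rot_act 1).
    apply/funext => x; apply/funext => l /=.
    by rewrite act1E /phi /rotate /cone_map; case: eqP => // _; rewrite act1E mulrCA.
  by rewrite !E.
- rewrite (chainB hhz) -(chainB hhz).
  (* On the support of the cone (g - 1) B_(2i+2) = delta B_(2i+1), so the pairing reduces to
     [zB]. *)
  transitivity (z (homotopy phi r (cobd (B (2 * i).+1)))); last by rewrite hd.
  apply: hhz.2 => s Qs; rewrite (B_cobd _ (simplexW dd0 iK Qs))/=.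
  by rewrite oddM/= -n2 addn2.
Qed.

(** h_(2K-1) pairs to 1 with delta B_(2K-2) = N B_(2K-1), yet its support consists of tuples of 2K
    points, where that cochain would vanish. *)
Lemma top_cochain_neq0 : (0 < K)%N ->
  ~ (forall s, simplex delta0 K (2 * K) s -> B (2 * K).-1 s = 0).
Proof.
move=> K0 Btop; have iK : (K.-1 < K)%N by rewrite prednK.
have d20 : 0 < delta0 / 2 by rewrite divr_gt0.
have d2d : delta0 / 2 <= delta0 by rewrite ler_pdivrMr// ler_peMr ?ler1n// ltW.
have [h [hh _ hB]] := even_chain_odd_chain iK delta0_gt0 (lexx _) (even_chain iK d20 d2d).
move/eqP: hB; rewrite eq_sym (chain0 hh) ?oner_eq0// => s.
have -> : (2 * K.-1 + 2 = 2 * K)%N by rewrite -mulnSr prednK.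
rewrite prednK// => Qs; rewrite (B_cobd _ Qs) oddM/= big1// => t _.
have -> : (2 * K.-1).+1 = (2 * K).-1 by rewrite -[in RHS](prednK K0) mulnS.
exact/Btop/simplex_act.
Qed.

End Sphere.

(** * Existence of small simplices carrying a full row of labels *)

Section Labelling.
Variables (C : numFieldType) (p : nat) (hp : prime p) (omega : C).
Hypotheses (omegap : omega ^+ p = 1) (K d : nat).

Hypothesis rot_path : forall eps : C, 0 < eps -> exists r (u : nat -> C),
  [/\ u 0%N = 1, u r = omega, forall k, `|u k| = 1 &
    forall k, `|u k.+1 - u k| <= eps].

Hypothesis cone_path : forall eps : C, 0 < eps -> exists r (c t : nat -> C),
  [/\ c 0%N = 0 /\ t 0%N = 1, c r = 1 /\ t r = 0,
     forall k, `|c k| ^+ 2 + `|t k| ^+ 2 = 1 &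
     forall k, `|c k.+1 - c k| <= eps /\ `|t k.+1 - t k| <= eps].

(** Without such a simplex the pullbacks of the label cochains satisfy all the equations on the
    sphere, while the last one vanishes on 2K labels by counting. *)
Lemma full_row_simplex (lambda : (nat -> C) -> 'I_d * 'F_p) (delta : C) :
  0 < delta -> (d * p.-1 < 2 * K)%N ->
  (forall t x, sph K K x -> lambda (rot_act omega t x) = label_shift t (lambda x)) ->
  exists n s, simplex K delta K n s /\ ~~ no_full_row (map lambda s).
Proof.
move=> delta0 dK lambdaE; apply: contrapT => no.
have good n s : simplex K delta K n s -> no_full_row (map lambda s).
  by move=> Qs; apply/negPn/negP => bad; apply: no; exists n, s.
have lambda_act t n s : simplex K delta K n s ->
    map lambda (map (rot_act omega t) s) = map (label_shift t) (map lambda s).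
  by case=> _ us _; rewrite -!map_comp; apply/eq_in_map => x /us; exact: lambdaE.
have K0 : (0 < K)%N by case: (K) dK => //; rewrite muln0 ltn0.
apply: (@top_cochain_neq0 _ _ hp _ omegap K rot_path cone_path
  (fun k s => label_cochain k (map lambda s)) delta delta0) => //.
- by move=> k; apply: normalised_map; by case: (alternating_label_cochain p d k).
- move=> s Qs; rewrite (lambda_act _ _ _ Qs) label_cochain0_shift size_map.
  by case: Qs => ->.
- move=> k n s Qs; rewrite (cobd_map lambda (label_cochain k)) cobd_label_cochain//; last first.
    exact: good Qs.
  rewrite (lambda_act _ _ _ Qs); case: ifP => // _.
  by apply: eq_bigr => t _; rewrite (lambda_act _ _ _ Qs).
- move=> s Qs; apply: label_cochain_large => //; first exact: good Qs.
  by rewrite size_map; case: Qs => ->.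
Qed.

End Labelling.

Local Open Scope classical_set_scope.
Local Open Scope ring_scope.

(** * Paths on the unit circle of C *)

Section UnitCircle.
Variable R : realType.
Implicit Types (a b theta : R) (z : R[i]).

Definition expi theta : R[i] := (cos theta +i* sin theta)%C.

Lemma expi0 : expi 0 = 1.
Proof. by rewrite /expi cos0 sin0. Qed.

Lemma expiD a b : expi (a + b) = expi a * expi b.
Proof. by apply/eqP; rewrite eq_complex /= cosD sinD eqxx addrC eqxx. Qed.

Lemma expiMn n theta : expi theta ^+ n = expi (theta *+ n).
Proof. by elim: n => [|n IH]; rewrite ?expr0 ?expi0// exprSr mulrSr expiD IH. Qed.

Lemma norm_expi theta : `|expi theta| = 1.
Proof. by rewrite normc_def /= cos2Dsin2 sqrtr1. Qed.

Lemma norm_real a : `|a%:C%C| = `|a|%:C%C :> R[i].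
Proof. by rewrite normc_def /= expr0n addr0 sqrtr_sqr. Qed.

Lemma normc_le_ReIm z : `|z| <= (`|complex.Re z| + `|complex.Im z|)%:C%C.
Proof.
rewrite {1}[z]complexE (le_trans (ler_normD _ _))// normrM !norm_real.
by rewrite normc_def /= expr0n add0r expr1n sqrtr1 mul1r -rmorphD.
Qed.

Lemma normc_ge_Im z : `|complex.Im z|%:C%C <= `|z|.
Proof.
have -> : `|complex.Im z| = `|complex.Re (z * 'i%C)| by rewrite ReiNIm normrN.
apply: le_trans (normc_ge_Re _) _; rewrite normrM.
by rewrite [`|'i%C|]normc_def /= expr0n add0r expr1n sqrtr1 mulr1.
Qed.

(** Comparable complex numbers have the same imaginary part, so a positive one is real. *)
Lemma pos_complexP (eps : R[i]) : 0 < eps -> exists2 e : R, 0 < e & eps = e%:C%C.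
Proof.
move=> e0; exists (complex.Re eps); last by rewrite RRe_real// gtr0_real.
by move: e0; rewrite ltcE => /andP[].
Qed.

Lemma expi_step theta (eps : R[i]) : 0 < eps ->
  exists2 r, (0 < r)%N & `|expi (theta / r%:R) - 1| <= eps.
Proof.
move=> /pos_complexP[e e0 ->].
have hc : \forall h \near (0 : R), `|cos h - 1| < e / 2.
  have : cos h @[h --> (0 : R)] --> cos 0 by exact: continuous_cos.
  rewrite cos0 => /cvgr_distC_lt; apply.
  by rewrite divr_gt0.
have hs : \forall h \near (0 : R), `|sin h| < e / 2.
  have : sin h @[h --> (0 : R)] --> sin 0 by exact: continuous_sin.
  rewrite sin0 => /cvgr0_norm_lt; apply.
  by rewrite divr_gt0.
have : \forall h \near (0 : R), `|cos h - 1| + `|sin h| < e.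
  near=> h; rewrite (splitr e); apply: ltrD; near: h; [exact: hc|exact: hs].
move=> /nbhs_normP[dl /= dl0 H].
(* Chosen so that [theta / r] has absolute value below [dl]. *)
pose r := (Num.truncn (`|theta| / dl)).+1.
exists r => //; apply: le_trans (normc_le_ReIm _) _; rewrite lecR /=.
rewrite oppr0 addr0; apply/ltW/H => /=; rewrite sub0r normrN normrM normfV normr_nat.
rewrite ltr_pdivrMr ?ltr0n// mulrC -ltr_pdivrMr//.
by have := truncnS_gt (`|theta| / dl).
Unshelve. all: by end_near. Qed.

(** Equal angular steps: by multiplicativity all chords have the length of the first one. *)
Lemma expi_path theta (eps : R[i]) : 0 < eps -> exists r (u : nat -> R),
  [/\ u 0%N = 0, u r = theta & forall k, `|expi (u k.+1) - expi (u k)| <= eps].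
Proof.
move=> e0; have [r r0 hr] := expi_step theta e0.
exists r, (fun k => (theta / r%:R) *+ k); split=> //.
  by rewrite -mulr_natr divfK// pnatr_eq0 -lt0n.
move=> k; rewrite mulrSr expiD -{2}[expi (_ *+ k)]mulr1 -mulrBr normrM norm_expi.
by rewrite mul1r.
Qed.

Lemma expi_rot_path theta (eps : R[i]) : 0 < eps -> exists r (u : nat -> R[i]),
  [/\ u 0%N = 1, u r = expi theta, forall k, `|u k| = 1 &
    forall k, `|u k.+1 - u k| <= eps].
Proof.
move=> e0; have [r [u [u0 ur uu]]] := expi_path theta e0.
exists r, (expi \o u); split=> //=; first by rewrite u0 expi0.
  by rewrite ur.
by move=> k; rewrite norm_expi.
Qed.

(** A quarter circle works: its real and imaginary parts move no faster than the point itself. *)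
Lemma expi_cone_path (eps : R[i]) : 0 < eps -> exists r (c t : nat -> R[i]),
  [/\ c 0%N = 0 /\ t 0%N = 1, c r = 1 /\ t r = 0,
     forall k, `|c k| ^+ 2 + `|t k| ^+ 2 = 1 &
     forall k, `|c k.+1 - c k| <= eps /\ `|t k.+1 - t k| <= eps].
Proof.
move=> e0; have [r [u [u0 ur uu]]] := expi_path (pi / 2) e0.
exists r, (fun k => (sin (u k))%:C%C), (fun k => (cos (u k))%:C%C); split.
- by rewrite u0 sin0 cos0.
- by rewrite ur sin_pihalf cos_pihalf.
- move=> k; rewrite !norm_real -!rmorphXn -rmorphD /= !real_normK ?num_real//.
  by rewrite addrC cos2Dsin2.
- move=> k; rewrite -!rmorphB !norm_real; split; apply: le_trans (uu k).
    exact: (normc_ge_Im (expi (u k.+1) - expi (u k))).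
  exact: (normc_ge_Re (expi (u k.+1) - expi (u k))).
Qed.

End UnitCircle.

(** * Identification of C^K with the first 2K real coordinates *)

Lemma norm_coord (R : realType) n (v : 'rV[R]_n) l : `|v 0 l| <= `|v|.
Proof.
rewrite [leRHS]/Num.norm /= mx_normrE.
exact: (le_bigmax _ (fun ij : 'I_1 * 'I_n => `|v ij.1 ij.2|) (0, l)).
Qed.

Section Realification.
Variables (R : realType) (m K : nat).
Hypothesis Km : (2 * K <= m.+1)%N.
Implicit Types (x y : nat -> R[i]) (v : 'rV[R]_m.+1).

Definition real_coord x l : R :=
  if odd l then complex.Im (x l./2) else complex.Re (x l./2).

Definition realify x : 'rV[R]_m.+1 := \row_(l < m.+1) real_coord x l.

(** For [l < K] both indices are below [2 * K <= m.+1], so [inord] never takes its default value. *)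
Definition complexify v : nat -> R[i] := fun l =>
  if (l < K)%N then (v 0 (inord (2 * l)) +i* v 0 (inord (2 * l).+1))%C else 0.

Lemma sum_pairs (G : nat -> R) n :
  \sum_(0 <= l < 2 * n) G l = \sum_(k < n) (G (2 * k)%N + G (2 * k).+1).
Proof.
elim: n => [|n IH]; first by rewrite muln0 big_geq// big_ord0.
by rewrite mulnS add2n !big_nat_recr//= IH big_ord_recr/= addrA.
Qed.

Lemma real_coord2 x k : real_coord x (2 * k) = complex.Re (x k).
Proof. by rewrite /real_coord oddM/= mul2n doubleK. Qed.

Lemma real_coord2S x k : real_coord x (2 * k).+1 = complex.Im (x k).
Proof. by rewrite /real_coord /= oddM/= mul2n uphalf_double. Qed.

Lemma dotp_realify x y : (forall l, (K <= l)%N -> x l = 0) ->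
  dotp (realify x) (realify y) = \sum_(k < K)
    (complex.Re (x k) * complex.Re (y k) + complex.Im (x k) * complex.Im (y k)).
Proof.
move=> x0; pose G l := real_coord x l * real_coord y l.
rewrite /dotp (eq_bigr (fun l : 'I_m.+1 => G l)); last by move=> l _; rewrite !mxE.
rewrite -(big_mkord xpredT G) (big_cat_nat _ Km)//= [X in _ + X]big_nat_cond.
rewrite [X in _ + X]big1 ?addr0.
  by rewrite sum_pairs; apply: eq_bigr => k _; rewrite /G !real_coord2 !real_coord2S.
move=> l /andP[/andP[Kl _] _]; rewrite /G /real_coord x0 ?if_same ?mul0r//.
by rewrite geq_half_double -mul2n.
Qed.

Lemma sph_dotp x : sph K K x <->
  (forall l, (K <= l)%N -> x l = 0) /\ dotp (realify x) (realify x) = 1.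
Proof.
have E : (\sum_(k < K) (complex.Re (x k) * complex.Re (x k) +
     complex.Im (x k) * complex.Im (x k)))%:C%C = \sum_(l < K) `|x l| ^+ 2.
  by rewrite rmorph_sum; apply: eq_bigr => k _; rewrite /= -add_Re2_Im2.
split=> -[h1 h2]; split=> //; first by rewrite dotp_realify//; apply: complexI; rewrite E.
by rewrite -E -(@dotp_realify x x)// h2.
Qed.

Lemma complexifyK v : (forall l : 'I_m.+1, (2 * K <= l)%N -> v 0 l = 0) ->
  realify (complexify v) = v.
Proof.
move=> v0; apply/rowP => l; rewrite mxE /real_coord /complexify.
have le : l = (2 * l./2 + odd l)%N :> nat by rewrite mul2n addnC odd_double_half.
have lt : (2 * l./2 + odd l < m.+1)%N by rewrite -le.
case: ltnP => [lK|Kl].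
  case: ifP le lt => ol le lt /=; congr (v 0 _); apply/val_inj.
    by rewrite addn1 in le lt; rewrite /= (inordK lt) -le.
  by rewrite addn0 in le lt; rewrite /= (inordK lt) -le.
rewrite v0 ?if_same//; apply: leq_trans (_ : 2 * l./2 <= _)%N; first by rewrite leq_mul2l.
by rewrite [X in (_ <= X)%N]le leq_addr.
Qed.

Lemma realify_close x y (delta : R) :
  0 <= delta -> (forall l, `|x l - y l| <= delta%:C%C) ->
  `|realify x - realify y| <= delta.
Proof.
move=> d0 xy; rewrite [leLHS]/Num.norm /= mx_normrE; apply: bigmax_le => // -[i l] _ /=.
rewrite !mxE /real_coord -lecR; apply: le_trans (xy l./2); case: ifP => _.
  by have := normc_ge_Im (x l./2 - y l./2); rewrite raddfB.
by have := normc_ge_Re (x l./2 - y l./2); rewrite raddfB.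
Qed.

(** The factor 2 comes from |z| <= |Re z| + |Im z|, the real norm being a supremum over
    coordinates. *)
Lemma close_realify x y (delta : R) :
  (forall l, (K <= l)%N -> x l = 0) -> (forall l, (K <= l)%N -> y l = 0) ->
  `|realify x - realify y| <= delta / 2 ->
  forall l, `|x l - y l| <= delta%:C%C.
Proof.
move=> x0 y0 xy l; have d0 : 0 <= delta / 2 by apply: le_trans xy.
have [lK|Kl] := ltnP l K; last first.
  by rewrite x0// y0// subrr normr0 lecR; lra.
apply: le_trans (normc_le_ReIm _) _; rewrite lecR (splitr delta).
have l0 : (2 * l < m.+1)%N by apply: leq_trans Km; rewrite ltn_pmul2l.
have l1 : ((2 * l).+1 < m.+1)%N.
  by apply: leq_trans Km; rewrite -add2n -mulnS leq_mul2l.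
apply: lerD.
  apply: le_trans (le_trans (norm_coord _ (Ordinal l0)) xy).
  by rewrite !mxE !real_coord2 raddfB.
apply: le_trans (le_trans (norm_coord _ (Ordinal l1)) xy).
by rewrite !mxE !real_coord2S raddfB.
Qed.

Lemma continuous_dotp : continuous (fun v => dotp v v).
Proof.
apply: continuous_big => [|i _ v]; first exact: add_continuous.
apply: (@cvgM _ _ (nbhs v)); exact: coord_continuous.
Qed.

Lemma sphereP v : sphere R m v <-> dotp v v = 1.
Proof.
rewrite /sphere /=; split=> [h|->]; last exact: sqrtr1.
have d0 : 0 <= dotp v v by apply: sumr_ge0 => i _; rewrite -expr2 sqr_ge0.
by rewrite -(sqr_sqrtr d0) h expr1n.
Qed.

Lemma compact_sphere : compact (sphere R m).
Proof.
apply: bounded_closed_compact.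
  exists 1; split=> // M M1 v /sphereP v1; apply: le_trans (ltW M1).
  rewrite [leLHS]/Num.norm /= mx_normrE; apply: bigmax_le => // -[i l] _ /=.
  rewrite (ord1 i) -(@expr_le1 _ 2)// real_normK ?num_real// -v1 /dotp (bigD1 l)//= expr2 lerDl.
  by apply: sumr_ge0 => j _; rewrite -expr2 sqr_ge0.
have -> : sphere R m = (fun v => dotp v v) @^-1` [set 1].
  by apply/seteqP; split=> v /sphereP.
by apply: closed_comp; [move=> v _; exact: continuous_dotp|exact: closed_eq].
Qed.

End Realification.

(** * Coincidence of the p values, by compactness *)

Section Coincidence.
Variables (R : realType) (p d m K : nat) (hp : prime p) (f : 'rV[R]_m.+1 -> 'rV[R]_d).
Hypotheses (hf : {within sphere R m, continuous f}) (Km : (2 * K <= m.+1)%N).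
Implicit Types (x z w : nat -> R[i]) (e : R).

Definition root_angle : R := 2 * pi / p%:R.

Local Notation theta := root_angle.
Local Notation omega := (expi theta).
Local Notation X := (nat -> R[i]).

Lemma omega_p : omega ^+ p = 1.
Proof.
rewrite expiMn -mulr_natr divfK; last by rewrite pnatr_eq0 -lt0n prime_gt0.
by rewrite mulr_natl /expi cos2pi -[_ *+ 2]add0r sinD2pi sin0.
Qed.

Lemma realify_continuous w e : sph K K w -> 0 < e ->
  exists2 delta : R, 0 < delta & forall x, sph K K x ->
    (forall l, `|x l - w l| <= delta%:C%C) ->
    forall j, `|f (realify m x) 0 j - f (realify m w) 0 j| <= e.
Proof.
move=> sw e0; have inS x : sph K K x -> sphere R m (realify m x).
  by move=> /(sph_dotp Km)[_ x1]; apply/sphereP.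
have /cvgrPdist_le/(_ e e0) := (subspace_continuousP _ _).1 hf _ (inS _ sw).
rewrite near_withinE => /nbhs_normP[dl /= dl0 H].
exists (dl / 2) => [|x sx xw j]; first by rewrite divr_gt0.
have xw' : `|realify m x - realify m w| <= dl / 2.
  by apply: realify_close xw; rewrite divr_ge0// ltW.
have /H/(_ (inS _ sx)) : `|realify m w - realify m x| < dl.
  by rewrite distrC (le_lt_trans xw')// ltr_pdivrMr// ltr_pMr// ltr1n.
apply: le_trans; rewrite distrC.
by have := norm_coord (f (realify m w) - f (realify m x)) j; rewrite !mxE.
Qed.

(* The sign makes multiplication of x by omega rot_act as a -> a + 1 on labels. *)
Definition orbit_table x : 'F_p -> 'I_d -> R :=
  fun a j => f (realify m (rot_act omega (- a) x)) 0 j.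

Lemma orbit_table_act t x : orbit_table (rot_act omega t x) = shift_table t (orbit_table x).
Proof.
apply/funext => a; apply/funext => j; rewrite /orbit_table /shift_table.
by rewrite (actD hp omega_p) opprB.
Qed.

Lemma orbit_table_continuous w e : sph K K w -> 0 < e ->
  exists2 delta : R, 0 < delta & forall x, sph K K x ->
    (forall l, `|x l - w l| <= delta%:C%C) ->
    forall a j, `|orbit_table x a j - orbit_table w a j| <= e.
Proof.
move=> sw e0.
suff [delta d0 H] : exists2 delta : R, 0 < delta & forall x, sph K K x ->
    (forall l, `|x l - w l| <= delta%:C%C) ->
    forall a, a \in enum 'F_p -> forall j, `|orbit_table x a j - orbit_table w a j| <= e.
  by exists delta => // x sx xw a j; apply: H => //; rewrite mem_enum.
elim: (enum 'F_p) => [|a s [d1 d10 H1]]; first by exists 1.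
have [d2 d20 H2] := realify_continuous (sph_act hp omega_p (- a) sw) e0.
exists (Num.min d1 d2) => [|x sx xw b]; first by rewrite lt_min d10.
have xw12 l : `|x l - w l| <= d1%:C%C /\ `|x l - w l| <= d2%:C%C.
  by split; apply: le_trans (xw l) _; rewrite lecR ge_min lexx ?orbT.
rewrite inE => /predU1P[->|bs] j; last by apply: H1 => // l; case: (xw12 l).
apply: H2; first exact: (sph_act hp omega_p).
by move=> l; rewrite /rot_act -mulrBr normrM (norm_omega hp omega_p) mul1r; case: (xw12 l).
Qed.

(** Points near which a whole row of labels occurs accumulate at some [z]. Close to it coordinate
    [i] both oscillates the most and is nearly maximal at every point of the orbit, so all
    oscillations at [z] vanish, against [nonconst]. *)
Lemma coincidence : (0 < d)%N -> (d * p.-1 < 2 * K)%N ->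
  exists2 z, sph K K z & forall t t' : 'F_p,
    f (realify m (rot_act omega t z)) = f (realify m (rot_act omega t' z)).
Proof.
move=> d0 dK; apply: contrapT => no.
have nonconst x : sph K K x -> exists j a b, orbit_table x a j != orbit_table x b j.
  move=> sx; apply: contrapT => cst; apply: no; exists x => // t t'.
  apply/rowP => j; apply: contrapT => /eqP ne; apply: cst.
  by exists j, (- t), (- t'); rewrite /orbit_table !opprK.
pose lambda x := table_label (Ordinal d0) (orbit_table x).
have lambdaE t x : sph K K x -> lambda (rot_act omega t x) = label_shift t (lambda x).
  by move=> sx; rewrite /lambda orbit_table_act table_label_shift//; exact: nonconst.
pose full (delta : R) x := sph K K x /\ exists i, forall a, exists x',
  [/\ sph K K x', forall l, `|x' l - x l| <= delta%:C%C & lambda x' = (i, a)].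
have fullP (delta : R) : 0 < delta -> exists x, full delta x.
  move=> dl0; have dlC : 0 < delta%:C%C :> R[i] by rewrite ltcR.
  have [n [s [[_ us cs]]]] := full_row_simplex hp omega_p
    (@expi_rot_path R theta) (@expi_cone_path R) dlC dK lambdaE.
  move=> /full_row[i rowi].
  have rP a : exists2 x, x \in s & lambda x = (i, a).
    by have /mapP[x xs ->] := rowi a; exists x.
  have [x xs _] := rP 0; exists x; split; first exact: us.
  exists i => a; have [x' xs' la] := rP a.
  by exists x'; split=> // [|l]; [exact: us|exact: cs].
have /choice[xs xsP] n : exists x, full n.+1%:R^-1 x.
  by apply: fullP; rewrite invr_gt0.
pose v n := realify m (xs n).
have vS n : sphere R m (v n).
  by apply/sphereP; have [/(sph_dotp Km)[]] := xsP n.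
have [|z' [z'S z'cl]] := @compact_sphere R m (v @ \oo) _; first by exists 0%N => // n _; exact: vS.
have clP e N : 0 < e -> exists2 n, (N <= n)%N & `|v n - z'| < e.
  move=> e0; have := z'cl [set v n | n in [set n | (N <= n)%N]] (ball z' e).
  case=> [||_ [[n Nn <-]]]; first by exists N => // n Nn; exists n.
    exact: nbhsx_ballx.
  by rewrite -ball_normE /= distrC => ?; exists n.
pose z : X := complexify K z'.
have zE : realify m z = z'.
  apply: complexifyK => l Kl; apply/eqP; apply: contrapT => /negP ne.
  (* Some [v n] is closer to [z'] than [|z' 0 l|], although its own coordinate [l] is 0. *)
  have [n _] := clP `|z' 0 l| 0%N (ltac:(by rewrite normr_gt0)).
  apply/negP; rewrite -leNgt.
  apply: le_trans (norm_coord _ l); rewrite !mxE /real_coord.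
  have [[_ x0] _] := xsP n.
  by rewrite x0 ?if_same ?sub0r ?normrN// geq_half_double -mul2n.
have sz : sph K K z.
  apply/(sph_dotp Km); split; first by move=> l Kl; rewrite /z /complexify ltnNge Kl.
  by rewrite zE; apply/sphereP.
have [j [b [c bc]]] := nonconst z sz.
suff le0 b' c' : orbit_table z b' j - orbit_table z c' j <= 0.
  by move/negP: bc; apply; rewrite eq_le -subr_le0 le0 -subr_le0 le0.
apply/ler_addgt0Pr => e e0; rewrite add0r.
(* The final estimate exchanges six table entries with those at [z], each at a cost of [e / 6]. *)
have e6 : 0 < e / 6 by rewrite divr_gt0.
have [dl dl0 H] := orbit_table_continuous sz e6.
(* For [n >= N] the mesh 1 / (n + 1) is at most [dl / 2]. The other half of [dl] bounds the distance
   from [xs n] to [z], and [close_realify] halves it once more. *)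
pose N := Num.truncn (dl / 2)^-1.
have [n Nn] := clP (dl / 2 / 2) N (ltac:(by rewrite !divr_gt0)).
rewrite -zE => /ltW/(close_realify Km) xz.
have [sx [i fx]] := xsP n.
have sz0 := sz.2; have sx0 := sx.2.
have near_z x' : sph K K x' -> (forall l, `|x' l - xs n l| <= (n.+1%:R^-1)%:C%C) ->
    forall a j, `|orbit_table x' a j - orbit_table z a j| <= e / 6.
  move=> sx' xx' a; apply: H => // l.
  rewrite -(subrKA (xs n l)) (splitr dl) rmorphD /=; apply: le_trans (ler_normD _ _) _.
  apply: lerD; last exact: xz.
  apply: le_trans (xx' l) _; rewrite lecR invf_ple ?posrE ?divr_gt0//.
  by apply: ltW; apply: lt_le_trans (truncnS_gt _) _; rewrite ler_nat.
have xxs l : `|xs n l - xs n l| <= (n.+1%:R^-1)%:C%C.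
  by rewrite subrr normr0 lecR invr_ge0.
(* [x1] provides the widest oscillation, from [b0] up to [a0]; at [x2] coordinate [i] is maximal at
   [b0], so there its value at [a0] is no larger. *)
have [x1 [sx1 cx1 lx1]] := fx 0.
have [_ [a0 [b0 wide]]] := table_label_spec lx1.
have [x2 [sx2 cx2 lx2]] := fx b0.
have [/(_ a0) top _] := table_label_spec lx2.
have W := wide j b' c'.
have := near_z _ sx1 cx1 b' j; have := near_z _ sx1 cx1 c' j.
have := near_z _ sx1 cx1 a0 i; have := near_z _ sx1 cx1 b0 i.
have := near_z _ sx2 cx2 a0 i; have := near_z _ sx2 cx2 b0 i.
rewrite !ler_distl => /andP[? ?] /andP[? ?] /andP[? ?] /andP[? ?] /andP[? ?] /andP[? ?].
lra.
Qed.

End Coincidence.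

(** * Hopf circles are great circles *)

Section HopfCircle.
Variables (R : realType) (m K : nat) (z : nat -> R[i]).
Hypotheses (Km : (2 * K <= m.+1)%N) (sz : sph K K z).
Implicit Types a b : R.

Definition hopf a : 'rV[R]_m.+1 := realify m (fun l => expi a * z l).

(** The real product is the real part of the Hermitian one, here e^(i(a - b)) |z|^2 with |z| = 1.
    Thus [hopf] is parametrised by arc length. *)
Lemma dotp_hopf a b : dotp (hopf a) (hopf b) = cos (a - b).
Proof.
rewrite (dotp_realify Km); last by move=> l Kl; rewrite sz.2// mulr0.
have [_] := (sph_dotp Km z).1 sz; rewrite (dotp_realify Km); last exact: sz.2.
move=> z1; rewrite -[RHS]mulr1 -z1 mulr_sumr; apply: eq_bigr => k _.
by rewrite cosB; case: (z k) => x y /=; ring.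
Qed.

Lemma hopfE a : hopf a = cos a *: hopf 0 + sin a *: hopf (pi / 2).
Proof.
apply/rowP => l; rewrite !mxE /real_coord /expi cos0 sin0 cos_pihalf sin_pihalf.
by case: (z l./2) => x y /=; case: ifP => _; ring.
Qed.

Lemma sphere_hopf a : sphere R m (hopf a).
Proof. by apply/sphereP; rewrite dotp_hopf subrr cos0. Qed.

Definition hopf_circle : set 'rV[R]_m.+1 :=
  sphere R m `&` [set x | x \in <<[:: hopf 0; hopf (pi / 2)]>>%VS].

(** By [dotp_hopf], the vectors [hopf 0] and [hopf (pi / 2)] are orthonormal and so span a plane. *)
Lemma great_circle_hopf : great_circle hopf_circle.
Proof.
exists <<[:: hopf 0; hopf (pi / 2)]>>%VS; split=> //.
suff /eqP : free [:: hopf 0; hopf (pi / 2)] by [].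
have dotp0 (v : 'rV[R]_m.+1) : dotp v 0 = 0.
  by rewrite /dotp big1// => i _; rewrite mxE mulr0.
rewrite free_cons seq1_free span_seq1; apply/andP; split; last first.
  apply/eqP => h0; have := dotp_hopf 0 (pi / 2); have := dotp_hopf (pi / 2) (pi / 2).
  by rewrite {2}h0 dotp0 subrr cos0 => /esym/eqP; rewrite oner_eq0.
apply/negP => /vlineP[k h0].
have h := dotp_hopf 0 (pi / 2); rewrite sub0r cosN cos_pihalf in h.
have : k * dotp (hopf (pi / 2)) (hopf (pi / 2)) = 0.
  rewrite -h h0 /dotp mulr_sumr; apply: eq_bigr => i _; rewrite !mxE mulrA.
  by [].
rewrite dotp_hopf subrr cos0 mulr1 => k0.
have := dotp_hopf 0 0; rewrite subrr cos0 {2}h0 k0 scale0r dotp0 => /esym/eqP.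
by rewrite oner_eq0.
Qed.

Lemma hopf_circle_hopf a : hopf_circle (hopf a).
Proof.
split; first exact: sphere_hopf.
by rewrite /= hopfE memvD// memvZ// memv_span// !inE eqxx ?orbT.
Qed.

End HopfCircle.

(** * Spherical distances on the circle and the conclusion *)

Lemma acos_cos_ge (R : realType) (a b : R) :
  0 <= a -> a <= b -> b <= 2 * pi - a -> a <= acos (cos b).
Proof.
move=> a0 ab ba; have [bpi|/ltW pib] := leP b pi.
  by rewrite cosK// in_itv /= (le_trans a0).
(* Reflection brings the angle back into [0, pi], where [acos] inverts [cos]. *)
have -> : cos b = cos (2 * pi - b).
  by rewrite -[LHS]cosN -(cosD2pi (- b)) addrC mulr_natl.
by rewrite cosK ?in_itv /=; [lra|apply/andP; split; lra].
Qed.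

Theorem theorem3p6 (R : realType) (p d m : nat) (hp : prime p) (hd : (0 < d)%N)
    (hm : (d * (p - 1) + 1 <= m)%N)
    (f : 'rV[R]_m.+1 -> 'rV[R]_d) (hf : {within sphere R m, continuous f}) :
  exists (C : set 'rV[R]_m.+1) (x : 'I_p -> 'rV[R]_m.+1),
    [/\ great_circle C,
        (forall i, C (x i)),
        (forall i j, i != j -> 2 * pi / p%:R <= sphere_dist (x i) (x j)) &
        (forall i j, f (x i) = f (x j))].
Proof.
(* The least K with d(p-1) < 2K; then 2K <= d(p-1) + 2 <= m + 1. *)
pose K := (d * p.-1)./2.+1.
have half2 := odd_double_half (d * p.-1).
have Km : (2 * K <= m.+1)%N.
  by rewrite /K mulnS mul2n add2n; move: hm; rewrite subn1 -half2 addn1; case: odd => /=; lia.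
have dK : (d * p.-1 < 2 * K)%N.
  by rewrite /K mulnS mul2n add2n -[X in (X < _)%N]half2; case: odd => /=; lia.
have [z sz fz] := coincidence hp hf Km hd dK.
have p0 : 0 < p%:R :> R by rewrite ltr0n prime_gt0.
pose theta := root_angle R p.
have th0 : 0 < theta by rewrite divr_gt0// mulr_gt0// pi_gt0.
have thp : theta * p%:R = 2 * pi by rewrite divfK// gt_eqF.
have xE (i : 'I_p) : hopf m z (theta *+ i) = realify m (rot_act (expi theta) (i%:R : 'F_p) z).
  congr (realify m _); apply/funext => l; rewrite /rot_act expiMn val_Fp_nat//.
  by rewrite modn_small.
exists (hopf_circle z), (fun i : 'I_p => hopf m z (theta *+ i)); split.
- exact: great_circle_hopf Km sz.
- by move=> i; exact: (hopf_circle_hopf Km sz).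
- move=> i j; rewrite -[2 * pi / _]/theta /sphere_dist (dotp_hopf Km sz).
  wlog ji : i j / (j < i)%N => [H ij|_].
    have [ji|ij'] : (j < i)%N \/ (i < j)%N by apply/orP; rewrite -neq_ltn eq_sym.
      exact: H.
    by rewrite -cosN opprB; apply: H => //; rewrite eq_sym.
  (* The angle is k theta with 1 <= k <= p - 1, hence lies between theta and (p - 1) theta = 2 pi -
     theta. *)
  rewrite -mulrnBr ?(ltnW ji)//; apply: acos_cos_ge; first exact: ltW.
    by rewrite -[leRHS]mulr_natr (ler_peMr (ltW th0))// ler1n subn_gt0.
  rewrite -thp -[X in _ - X]mulr1 -mulrBr -[leLHS]mulr_natr ler_pM2l//.
  by rewrite lerBrDr natr1 ler_nat (leq_ltn_trans (leq_subr _ _)).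
- by move=> i j; rewrite !xE; exact: fz.
Qed.
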